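(* Let $f,g\colon\mathbb{R}^n\to\mathbb{R}^n$ be smooth. Assume that the Jacobian of $f$ is symmetric, that is, $f_x(x)=f_x(x)^*$ for all $x\in\mathbb{R}^n$. Assume further that $a,b\in\mathbb{R}^n$ are hyperbolic equilibria of $\dot{x}=f(x)$ with $\dim W^{\mathrm{s}}(a)=n$ and $\dim W^{\mathrm{u}}(b)=1$, and that $h(t)$ is a solution of $\dot{x}=f(x)$ such that $h(0)\in W^{\mathrm{u}}(b)\cap W^{\mathrm{s}}(a)$ and $W^{\mathrm{u}}(b)$ and $W^{\mathrm{s}}(a)$ intersect transversely at $h(0)$. Set $y_0(t):=h(-t)$. For $|\mu|$ small, let $y_*(t;\mu)$ and $(u_*,v_* )(t;\mu)$ denote the heteroclinic solutions, described in the context, of the time-reversed system $$\dot{y}=-f(y)-\mu g(y)$$ and of the Euler--Lagrange system $$\dot{u}=-f(u)-\mu g(u)+v,\qquad \dot{v}=f_u(u)^*v+\mu\Big[2\big(g_u(u)^*-g_u(u)\big)\big(f(u)+\mu g(u)\big)+\big(2g_u(u)-g_u(u)^*\big)v\Big],$$ respectively, that continue $y_0(t)$ and $(y_0(t),0)$ from $\mu=0$. If there is an $s\in\mathbb{R}$ such that $$\Big[g_u(y_0(s))^*-g_u(y_0(s))\Big]f(y_0(s))\neq0,$$ then there are constants $\delta>0$ and $\mu_0>0$ such that $$\sup_{t\in\mathbb{R}}|y_*(t;\mu)-u_*(t;\mu)|\geq\delta|\mu|\quad\text{for all }\mu\text{ with }0<|\mu|<\mu_0.$$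
   Context: Notation: $f_x$ or $f_u$ denotes the Jacobian matrix of $f$ (similarly for $g$), and $^*$ denotes the transpose. $W^{\mathrm{s}}(e)$ and $W^{\mathrm{u}}(e)$ denote the stable and unstable manifolds of an equilibrium $e$. Under the stated hypotheses on $f$, $y_0(t)=h(-t)$ is a heteroclinic orbit of $\dot{y}=-f(y)$ from $a$ (at $t=-\infty$) to $b$ (at $t=+\infty$), and $(u_0,v_0)(t)=(h(-t),0)$ is a heteroclinic orbit of the system $\dot{u}=-f(u)+v$, $\dot{v}=f_u(u)^*v$ from $(a,0)$ to $(b,0)$. These heteroclinic orbits persist, for all $\mu$ with $|\mu|$ sufficiently small, as heteroclinic solutions $y_*(t;\mu)$ and $(u_*,v_* )(t;\mu)$ of the two $\mu$-dependent systems displayed in the claim. They connect, respectively, the equilibria $a_\mu$ to $b_\mu$ and $(a_\mu,0)$ to $(b_\mu,0)$, where $a_\mu,b_\mu$ are the equilibria of $\dot{x}=f(x)+\mu g(x)$ near $a,b$. These heteroclinic solutions are unique near the unperturbed orbits (up to time translation), and their time parametrizations are chosen so that $y_*(\cdot;\mu)$ and $(u_*,v_* )(\cdot;\mu)$ depend smoothly on $\mu$, uniformly in $t\in\mathbb{R}$ (that is, as maps from $\mu$ into bounded continuous functions on $\mathbb{R}$ with the supremum norm), with $y_*(t;0)=h(-t)$ and $(u_*,v_* )(t;0)=(h(-t),0)$. *)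

(* Defs.v *)
From HB Require Import structures.
From mathcomp Require Import all_boot all_order all_algebra.
From mathcomp Require Import all_classical all_reals all_analysis.
From mathcomp Require Import complex.
Set Implicit Arguments.
Unset Strict Implicit.
Unset Printing Implicit Defensive.
Import Order.TTheory GRing.Theory Num.Theory.
Import numFieldNormedType.Exports.
Local Open Scope classical_set_scope.
Local Open Scope ring_scope.

(* R^n is 'rV[R]_n.  The library Jacobian 'J acts on row vectors from the
   right, i.e. it is the transpose of the usual Jacobian matrix
   (d f_i / d x_j)_(i, j); Jac is the usual one, and A *v w is the usual
   product of the matrix A with the (column) vector w. *)
Definition Jac (R : realType) (n : nat) (f : 'rV[R]_n -> 'rV[R]_n)
  (x : 'rV[R]_n) : 'M[R]_n := ('J f x)^T.

Definition mulmxv (R : realType) (n : nat) (A : 'M[R]_n) (w : 'rV[R]_n) :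
  'rV[R]_n := w *m A^T.

Notation "A *v w" := (mulmxv A w) (at level 40, left associativity) : ring_scope.

Fixpoint Ck (R : realType) (n : nat) (k : nat) (f : 'rV[R]_n -> 'rV[R]_n) :
  Prop :=
  if k is k'.+1 then
    (forall x, differentiable f x) /\ (forall v, Ck k' ('D_v f))
  else continuous f.

Definition smooth (R : realType) (n : nat) (f : 'rV[R]_n -> 'rV[R]_n) : Prop :=
  forall k, Ck k f.

Definition hyperbolic_equilibrium (R : realType) (n : nat)
  (F : 'rV[R]_n -> 'rV[R]_n) (e : 'rV[R]_n) : Prop :=
  F e = 0 /\
  forall z : R[i],
    eigenvalue (map_mx (real_complex R) (Jac F e)) z -> complex.Re z != 0.

Definition solves_on (R : realType) (V : normedModType R) (D : set R)
  (F : V -> V) (x : R -> V) : Prop :=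
  forall t, D t -> is_derive t 1 x (F (x t)).

(* Solutions on a closed half-line are functions on R whose values off the
   half-line are irrelevant; the two-sided derivative at 0 is no restriction,
   as such a solution extends affinely beyond 0. *)
Definition stable_manifold (R : realType) (n : nat)
  (F : 'rV[R]_n -> 'rV[R]_n) (e : 'rV[R]_n) : set 'rV[R]_n :=
  [set p | exists x : R -> 'rV[R]_n,
     [/\ solves_on [set t | 0 <= t] F x, x 0 = p & x t @[t --> +oo] --> e]].

Definition unstable_manifold (R : realType) (n : nat)
  (F : 'rV[R]_n -> 'rV[R]_n) (e : 'rV[R]_n) : set 'rV[R]_n :=
  [set p | exists x : R -> 'rV[R]_n,
     [/\ solves_on [set t | t <= 0] F x, x 0 = p & x t @[t --> -oo] --> e]].

(* Tangent vectors are the velocities of curves c |-> X c 0 in the manifold.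
   The stable manifold is only injectively immersed, so a curve has to be taken
   with respect to its intrinsic topology: this is the requirement that the
   orbits X c started on the curve converge to e uniformly in c, i.e. that they
   all lie in the (embedded) local stable manifold after a common time. *)
Definition stable_tangent (R : realType) (n : nat)
  (F : 'rV[R]_n -> 'rV[R]_n) (e p : 'rV[R]_n) : set 'rV[R]_n :=
  [set w | exists r : R, exists X : R -> R -> 'rV[R]_n,
     [/\ 0 < r,
         forall c, `|c| < r -> solves_on [set t | 0 <= t] F (X c),
         forall d, 0 < d ->
           \forall t \near +oo, forall c, `|c| < r -> `|X c t - e| < d,
         X 0 0 = p
       & is_derive (0 : R) (1 : R) (fun c => X c 0) w]].

Definition unstable_tangent (R : realType) (n : nat)
  (F : 'rV[R]_n -> 'rV[R]_n) (e p : 'rV[R]_n) : set 'rV[R]_n :=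
  [set w | exists r : R, exists X : R -> R -> 'rV[R]_n,
     [/\ 0 < r,
         forall c, `|c| < r -> solves_on [set t | t <= 0] F (X c),
         forall d, 0 < d ->
           \forall t \near -oo, forall c, `|c| < r -> `|X c t - e| < d,
         X 0 0 = p
       & is_derive (0 : R) (1 : R) (fun c => X c 0) w]].

(* The dimension of the manifold W with tangent spaces T p. *)
Definition manifold_dim (R : realType) (n : nat) (W : set 'rV[R]_n)
  (T : 'rV[R]_n -> set 'rV[R]_n) (k : nat) : Prop :=
  forall p, W p -> exists U : {vspace 'rV[R]_n}, \dim U = k /\ T p = [set` U].

Definition transverse (R : realType) (n : nat) (T1 T2 : set 'rV[R]_n) : Prop :=
  forall w, exists w1 w2, [/\ T1 w1, T2 w2 & w = w1 + w2].

Definition heteroclinic (R : realType) (V : normedModType R) (F : V -> V)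
  (p q : V) (x : R -> V) : Prop :=
  [/\ solves_on setT F x, x t @[t --> -oo] --> p & x t @[t --> +oo] --> q].

(* z, defined for |mu| < m, is C^infinity as a map from mu into the bounded
   continuous functions R -> V with the supremum norm; D k is its k-th
   derivative. *)
Definition smooth_in_BC (R : realType) (V : normedModType R) (m : R)
  (z : R -> R -> V) : Prop :=
  exists D : nat -> R -> R -> V,
    (forall mu, `|mu| < m -> D 0%N mu = z mu) /\
    forall k mu, `|mu| < m ->
      [/\ continuous (D k mu), bounded_fun (D k mu)
        & forall eps, 0 < eps -> \forall r \near (0 : R), forall t,
            `|D k (mu + r) t - D k mu t - r *: D k.+1 mu t| <= eps * `|r|].

Definition perturbed (R : realType) (n : nat) (f g : 'rV[R]_n -> 'rV[R]_n)
  (mu : R) (x : 'rV[R]_n) : 'rV[R]_n := f x + mu *: g x.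

Definition reversed (R : realType) (n : nat) (f g : 'rV[R]_n -> 'rV[R]_n)
  (mu : R) (y : 'rV[R]_n) : 'rV[R]_n := - f y - mu *: g y.

Definition euler_lagrange (R : realType) (n : nat)
  (f g : 'rV[R]_n -> 'rV[R]_n) (mu : R) (w : 'rV[R]_n * 'rV[R]_n) :
  'rV[R]_n * 'rV[R]_n :=
  let: (u, v) := w in
  (- f u - mu *: g u + v,
   (Jac f u)^T *v v
   + mu *: ((2%:R *: ((Jac g u)^T - Jac g u)) *v (f u + mu *: g u)
            + (2%:R *: Jac g u - (Jac g u)^T) *v v)).

(* The equilibria e_ mu of x' = f(x) + mu g(x) near e, for |mu| < m: continuity
   at mu = 0 singles them out when e is hyperbolic. *)
Definition continues_equilibrium (R : realType) (n : nat)
  (f g : 'rV[R]_n -> 'rV[R]_n) (e : 'rV[R]_n) (m : R) (e_ : R -> 'rV[R]_n) :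
  Prop :=
  [/\ e_ 0 = e, {for 0, continuous e_}
    & forall mu, `|mu| < m -> perturbed f g mu (e_ mu) = 0].

(* Main.v *)
Require Import Defs.
From HB Require Import structures.
From mathcomp Require Import all_boot all_order all_algebra.
From mathcomp Require Import all_classical all_reals all_analysis.
From mathcomp Require Import ring lra.
Import Order.TTheory GRing.Theory Num.Theory.
Import numFieldNormedType.Exports.
Local Open Scope classical_set_scope.
Local Open Scope ring_scope.

Set Implicit Arguments.
Unset Strict Implicit.

(** Let [y1] and [(u1, v1)] be the derivatives with respect to [mu], at
    [mu = 0], of the two families of heteroclinic solutions.  If [y1] and [u1]
    differ at a single time [t], then [u mu t - y mu t] equals
    [mu *: (u1 t - y1 t)] up to [o(mu)], and this time alone bounds the supremum
    from below by a multiple of [|mu|] ([dist_ge_of_variation]).  So it is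
    enough to see that [u1 = y1] is incompatible with the skew part of the
    Jacobian of [g] acting nontrivially on [f] along [h].

    Divide the differential equations by [mu] and let [mu] tend to [0].
    - The equation of [u] is the equation of [y] with the extra term [v], so the
      derivative of [(u - y) / mu] tends to [v1] once [(u - y) / mu] tends to
      [0], because [f] is locally Lipschitz.  Hence [u1 = y1] forces [v1 = 0]
      ([costate_variation_eq0]).
    - In the equation of [v] the only term of order [mu] that does not contain
      [v] is [mu] times twice the skew part of the Jacobian of [g] applied to
      [f].  Hence [v1 = 0] forces that vector to vanish along [h]
      ([skew_force_eq0]), which contradicts the hypothesis.

    In both steps a family of curves converges and so do their velocities, and
    the limit of the velocities has to be the velocity of the limit;
    [limit_derivative_eq0] is this principle for a vanishing limit curve.  The
    limits themselves come from the smooth dependence on [mu]: as it is uniform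
    in time, the difference quotients in [mu] converge when [mu] tends to [0]
    and the time tends to [t] simultaneously ([first_variation]). *)

(** Pairs [(mu, s)] with [mu -> 0], [mu != 0], and simultaneously [s -> t]: a
    limit along this filter is the local form of uniformity in time. *)
Local Notation joint T t := (filter_prod (0 : T)^' (nbhs (t : T))).

(** * Convergence of matrices, entry by entry *)

Lemma le_coord_norm (K : realDomainType) m n (A : 'M[K]_(m, n)) i j :
  `|A i j| <= `|A|.
Proof.
by rewrite [leRHS]/Num.Def.normr/= mx_normrE; exact: (le_bigmax _ _ (i, j)).
Qed.

Lemma mx_norm_le (K : realDomainType) m n (A : 'M[K]_(m, n)) (c : K) :
  0 <= c -> (forall i j, `|A i j| <= c) -> `|A| <= c.
Proof.
move=> c0 Ac; rewrite [leLHS]/Num.Def.normr/= mx_normrE.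
by apply: bigmax_le => // -[i j] _; exact: Ac.
Qed.

Section limits.
Context {R : realType} {T : Type} {F : set_system T} {FF : Filter F}.

Lemma cvg_mx m n (A : T -> 'M[R]_(m, n)) (B : 'M[R]_(m, n)) :
  (forall i j, A x i j @[x --> F] --> B i j) -> A @ F --> B.
Proof.
move=> AB; apply/cvgrPdist_le => e e0.
have : \forall x \near F, forall i j, `|B i j - A x i j| <= e.
  apply: filter_forall => i; apply: filter_forall => j.
  exact: ((cvgrPdist_le _ _).1 (AB i j)).
apply: filterS => x ABx; apply: mx_norm_le; first exact: ltW.
by move=> i j; rewrite !mxE.
Qed.

Lemma cvg_coord m n (A : T -> 'M[R]_(m, n)) (B : 'M[R]_(m, n)) i j :
  A @ F --> B -> A x i j @[x --> F] --> B i j.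
Proof.
apply: (@continuous_cvg _ _ _ F _ A (fun M => M i j)).
exact: coord_continuous.
Qed.

Lemma cvg_trmx m n (A : T -> 'M[R]_(m, n)) (B : 'M[R]_(m, n)) :
  A @ F --> B -> (A x)^T @[x --> F] --> B^T.
Proof.
move=> AB; apply: cvg_mx => i j; rewrite mxE.
by under eq_cvg do rewrite mxE; exact: cvg_coord.
Qed.

Lemma cvg_mulmxv n (A : T -> 'M[R]_n) (A0 : 'M[R]_n) (w : T -> 'rV[R]_n)
    (w0 : 'rV[R]_n) :
  A @ F --> A0 -> w @ F --> w0 -> A x *v w x @[x --> F] --> A0 *v w0.
Proof.
move=> AA0 ww0; apply: cvg_mx => i j; rewrite !mxE.
under eq_cvg do rewrite mxE.
apply: cvg_big => [|k _]; first exact: add_continuous.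
apply: cvgM; first exact: cvg_coord.
by apply: cvg_coord; exact: cvg_trmx.
Qed.

End limits.

(** * Directional derivatives of composites *)

Section derivatives.
Context {R : realType} {V : normedModType R}.

Lemma is_derive_coord m n (M : V -> 'M[R]_(m, n)) (x w : V) (dM : 'M[R]_(m, n))
    i j :
  is_derive x w M dM -> is_derive x w (fun t => M t i j) (dM i j).
Proof.
move=> [Mx <-]; apply: DeriveDef; first exact: (derivable_mxP _ _ _).1.
by rewrite derive_mx// mxE.
Qed.

Lemma is_derive_line (W : normedModType R) (f : V -> W) (x w : V) (s : R) :
  differentiable f (s *: w + x) ->
  is_derive s 1 (fun s => f (s *: w + x)) ('D_w f (s *: w + x)).
Proof.
have quotientE : (fun h : R => h^-1 *:
      (((fun s => f (s *: w + x)) \o shift s) (h *: 1) - f (s *: w + x))) =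
    (fun h => h^-1 *: ((f \o shift (s *: w + x)) (h *: w) - f (s *: w + x))).
  by apply/funext => h /=; rewrite [h *: 1]mulr1 scalerDl addrA.
by move=> df; apply: DeriveDef; rewrite /derivable /derive quotientE//;
  exact: diff_derivable.
Qed.

Lemma is_derive_linear (W W' : normedModType R) (L : {linear W -> W'})
    (z : V -> W) (x w : V) (dz : W) :
  continuous L -> is_derive x w z dz -> is_derive x w (L \o z) (L dz).
Proof.
move=> Lc [zx <-].
have Lz : h^-1 *: (((L \o z) \o shift x) (h *: w) - (L \o z) x) @[h --> 0^']
    --> L ('D_w z x).
  under eq_cvg do rewrite /= -linearB -linearZ.
  by apply: (@continuous_cvg _ _ _ _ _ _ L) => //; exact: Lc.
by apply: DeriveDef; [apply/cvg_ex; exists (L ('D_w z x)) | exact/cvg_lim].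
Qed.

End derivatives.

(** * Local Lipschitz continuity *)

Lemma jacobian_continuous (R : realType) n (f : 'rV[R]_n -> 'rV[R]_n) :
  Ck 1 f -> continuous (fun x => 'J f x).
Proof.
move=> [df cDf] x; apply: (@cvg_mx _ _ (nbhs x)) => i j.
have JE y : 'J f y i j = ('D_(delta_mx 0 i) f y) 0 j.
  by rewrite deriveEjacobian// -rowE [RHS]mxE.
under eq_cvg do rewrite JE.
rewrite JE; apply: (@cvg_coord _ _ (nbhs x)); exact: cDf.
Qed.

Lemma norm_mulmx_le (R : realType) n (w : 'rV[R]_n) (A : 'M[R]_n) :
  `|w *m A| <= n%:R * `|A| * `|w|.
Proof.
apply: mx_norm_le => [|i j]; first by rewrite !mulr_ge0.
rewrite mxE (le_trans (ler_norm_sum _ _ _))//.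
have -> : n%:R * `|A| * `|w| = \sum_(k < n) `|w| * `|A|.
  by rewrite sumr_const card_ord -[RHS]mulr_natl -mulrA [`|A| * _]mulrC.
by apply: ler_sum => k _; rewrite normrM ler_pM ?le_coord_norm.
Qed.

(** The Jacobian is bounded near [p] because it is continuous there, and balls
    are convex, so the mean value theorem applies along the segment between two
    points. *)
Lemma C1_locally_lipschitz (R : realType) n (f : 'rV[R]_n -> 'rV[R]_n)
    (p : 'rV[R]_n) :
  Ck 1 f -> exists2 K, 0 <= K &
    exists2 e, 0 < e &
    forall q r, `|p - q| < e -> `|p - r| < e -> `|f q - f r| <= K * `|q - r|.
Proof.
move=> C1f; have df := C1f.1.
have /cvgrPdist_lt/(_ 1 ltr01)/nbhs_ballP[e /= e0 Je] :
  {for p, continuous (fun x => 'J f x)} by exact: jacobian_continuous.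
exists (n%:R * (`|'J f p| + 1)); first by rewrite mulr_ge0// addr_ge0.
exists e => // q r pq pr.
apply: mx_norm_le => [|i j]; first by rewrite !mulr_ge0// addr_ge0.
rewrite !mxE ord1 => {i}.
pose c (s : R) := s *: (q - r) + r.
have dc (s : R) :
    is_derive s (1 : R) (fun s => f (c s) 0 j) (((q - r) *m 'J f (c s)) 0 j).
  by rewrite -deriveEjacobian//; apply/is_derive_coord/is_derive_line.
have [s /itvP s01] : exists2 s, s \in `]0, 1[%R &
    f (c 1) 0 j - f (c 0) 0 j = ((q - r) *m 'J f (c s)) 0 j * (1 - 0).
  apply: (MVT (f := fun s => f (c s) 0 j)) => //.
  by apply: derivable_within_continuous => s _;
    exact: (@ex_derive _ _ _ _ _ _ _ (dc s)).
rewrite {1 2}/c scale1r subrK scale0r add0r subr0 mulr1 => ->.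
apply: le_trans (le_coord_norm _ _ _) _.
apply: le_trans (norm_mulmx_le _ _) _.
rewrite ler_wpM2r// ler_wpM2l// -lerBlDl (le_trans (lerB_dist _ _))// distrC.
(* It remains to see that the intermediate point lies in the ball. *)
apply/ltW/Je; rewrite -ball_normE/= /c.
have -> : p - (s *: (q - r) + r) = s *: (p - q) + (1 - s) *: (p - r).
  by apply/matrixP => k l; rewrite !mxE; ring.
apply: le_lt_trans (ler_normD _ _) _; rewrite !normrZ.
rewrite !ger0_norm ?s01 ?subr_ge0 ?s01//.
have -> : e = s * e + (1 - s) * e by rewrite -mulrDl addrC subrK mul1r.
by rewrite ltrD// ltr_pM2l// ?subr_gt0 s01.
Qed.

(** Used with [c = 1 / mu]: if [q] and [r] agree to first order in [mu], then so
    do [f q] and [f r]. *)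
Lemma cvg0_scaled_difference (R : realType) n (f : 'rV[R]_n -> 'rV[R]_n)
    (p : 'rV[R]_n) (T : Type) (F : set_system T) {FF : Filter F} (c : T -> R)
    (q r : T -> 'rV[R]_n) :
  Ck 1 f -> q @ F --> p -> r @ F --> p ->
  c x *: (q x - r x) @[x --> F] --> (0 : 'rV[R]_n) ->
  c x *: (f (q x) - f (r x)) @[x --> F] --> (0 : 'rV[R]_n).
Proof.
move=> /(C1_locally_lipschitz p)[K K0 [d d0 fK]] qp rp qr0.
apply/cvgrPdist_lt => e e0.
(* [K] may be [0], so the division is by [K + 1]. *)
have K1 : 0 < K + 1 by rewrite ltr_wpDl.
have eK : 0 < e / (K + 1) by rewrite divr_gt0.
move/cvgrPdist_lt : qp => /(_ _ d0) qp; move/cvgrPdist_lt : rp => /(_ _ d0) rp.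
move/cvgrPdist_lt : qr0 => /(_ _ eK) qr0.
near=> x; rewrite sub0r normrN normrZ.
apply: (@le_lt_trans _ _ ((K + 1) * (`|c x| * `|q x - r x|))).
  rewrite mulrCA ler_wpM2l//.
  rewrite (@le_trans _ _ (K * `|q x - r x|))//; last first.
    by rewrite ler_wpM2r// lerDl.
  by apply: fK; near: x.
rewrite mulrC -ltr_pdivlMr// -normrZ -normrN -sub0r.
by near: x.
Unshelve. all: by end_near. Qed.

(** * Limits of derivatives *)

(** Over a time interval of length [d / 2] starting at [t0], an entry of [x i]
    changes by about [d / 2] times the corresponding entry of [l], by the mean
    value theorem; but this change tends to [0] with [x i].  The convergence of
    the velocities has to be joint in [i] and [t], since the intermediate time
    depends on [i]. *)
Lemma limit_derivative_eq0 (R : realType) m n (I : Type) (F : set_system I)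
    {FF : ProperFilter F} (x dx : I -> R -> 'M[R]_(m, n)) (t0 : R)
    (l : 'M[R]_(m, n)) :
  (\forall i \near F, forall t : R, is_derive t (1 : R) (x i) (dx i t)) ->
  (forall t, x i t @[i --> F] --> (0 : 'M[R]_(m, n))) ->
  dx p.1 p.2 @[p --> filter_prod F (nbhs t0)] --> l -> l = 0.
Proof.
move=> dxE x0 dxl; apply/matrixP => j k; rewrite [RHS]mxE.
apply/eqP; rewrite -normr_le0; apply/ler_addgt0Pr => e e0; rewrite add0r.
have e20 : 0 < e / 2 by rewrite divr_gt0.
move/cvgrPdist_lt : dxl => /(_ _ e20)[[/= A B] [FA /nbhs_ballP[d /= d0 dB]] AB].
have d20 : 0 < d / 2 by rewrite divr_gt0.
pose t1 := t0 + d / 2.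
have small t : \forall i \near F, `|x i t j k| < e / 2 * (d / 2) / 2.
  have c0 : 0 < e / 2 * (d / 2) / 2 by rewrite !(divr_gt0, mulr_gt0).
  move/cvgrPdist_lt : (x0 t) => /(_ _ c0); apply: filterS => i.
  by rewrite sub0r normrN; apply: le_lt_trans; exact: le_coord_norm.
have [i [Ai dxi [xi1 xi0]]] : exists i, [/\ A i,
    (forall t : R, is_derive t (1 : R) (x i) (dx i t)) &
    `|x i t1 j k| < e / 2 * (d / 2) / 2 /\ `|x i t0 j k| < e / 2 * (d / 2) / 2].
  apply: (@filter_ex _ F); near=> i.
  split; [by near: i|by near: i|].
  by split; near: i; exact: small.
have dxijk (t : R) : is_derive t (1 : R) (fun t => x i t j k) (dx i t j k).
  exact: is_derive_coord.
have [c] : exists2 c, c \in `]t0, t1[%R &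
    x i t1 j k - x i t0 j k = dx i c j k * (t1 - t0).
  apply: (MVT (f := fun t => x i t j k)) => //; first by rewrite ltrDl.
  by apply: derivable_within_continuous => t _;
    exact: (@ex_derive _ _ _ _ _ _ _ (dxijk t)).
rewrite in_itv/= {2}/t1 addrAC subrr add0r => /andP[t0c ct1] dxc.
have lc : `|l j k - dx i c j k| < e / 2.
  have : `|l - dx i c| < e / 2.
    apply: (AB (i, c)); split => //=; apply: dB; rewrite /ball/=.
    by rewrite ltr_norml; apply/andP; split; rewrite /t1 in ct1; lra.
  by apply: le_lt_trans; have := le_coord_norm (l - dx i c) j k; rewrite !mxE.
have dc : `|dx i c j k| <= e / 2.
  rewrite -(ler_pM2r d20) -{1}(gtr0_norm d20) -normrM -dxc.
  by rewrite (le_trans (ler_normB _ _))//; lra.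
rewrite -(subrK (dx i c j k) (l j k)) (le_trans (ler_normD _ _))//.
by rewrite (splitr e) lerD// ltW.
Unshelve. all: by end_near. Qed.

(** * Smooth families of bounded curves *)

Lemma cvg_slice (R : realType) (V : topologicalType) (I : Type)
    (F : set_system I) {FF : Filter F} (x : I -> R -> V) (t : R) (l : V) :
  x p.1 p.2 @[p --> filter_prod F (nbhs t)] --> l -> x i t @[i --> F] --> l.
Proof.
move=> xl A lA; have [[P Q] /= [FP Qt] PQ] := xl A lA.
suff : F ((x^~ t) @^-1` A) by [].
apply: filterS FP => i Pi; have PQit : (P `*` Q) (i, t).
  by split=> //=; exact: nbhs_singleton.
exact: (PQ _ PQit).
Qed.

Lemma near_fst_neq0 (R : realType) (t0 : R) :
  \forall p \near joint R t0, p.1 != 0.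
Proof.
have fst0 : p.1 @[p --> joint R t0] --> (0 : R)^'.
  exact: cvg_fst.
exact: (fst0 _ (nbhs_dnbhs_neq (0 : R))).
Qed.

Lemma cvg_fst0 (R : realType) (t0 : R) : p.1 @[p --> joint R t0] --> (0 : R).
Proof.
have to0 : (0 : R)^' --> (0 : R) by exact: cvg_within.
by move=> A /to0; exact: cvg_fst.
Qed.

Lemma smooth_in_BC_continuous0 (R : realType) (V : normedModType R) (m : R)
    (z : R -> R -> V) :
  0 < m -> smooth_in_BC m z -> continuous (z 0).
Proof.
move=> m0 z_smooth.
have [D [D0 DS]] := z_smooth; have m00 : `|0 : R| < m by rewrite normr0.
by rewrite -D0//; have [] := DS 0%N 0 m00.
Qed.

(** The remainder of the expansion of [z mu] at [mu = 0] is uniform in time and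
    the first derivative in [mu] is continuous in time, so the difference
    quotients converge jointly in [mu] and [t]. *)
Lemma first_variation (R : realType) (V : normedModType R) (m : R)
    (z : R -> R -> V) :
  0 < m -> smooth_in_BC m z ->
  exists z1 : R -> V, forall t,
    p.1^-1 *: (z p.1 p.2 - z 0 p.2) @[p --> joint R t] --> z1 t.
Proof.
move=> m0 z_smooth.
have [D [D0 DS]] := z_smooth; have m00 : `|0 : R| < m by rewrite normr0.
exists (D 1%N 0) => t0; apply/cvgrPdist_le => e e0.
have e20 : 0 < e / 2 by rewrite divr_gt0.
have [_ _ /(_ _ e20) D01] := DS 0%N 0 m00.
have [/(_ t0)/cvgrPdist_le/(_ _ e20) D1 _ _] := DS 1%N 0 m00.
apply: (@filter_pair_set _ _ _ _ _ _
  [set mu : R | [/\ mu != 0, `|mu| < m & forall t,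
   `|D 0%N (0 + mu) t - D 0%N 0 t - mu *: D 1%N 0 t| <= e / 2 * `|mu|]]
  [set t | `|D 1%N 0 t0 - D 1%N 0 t| <= e / 2]).
  move=> mu t /= [mu0 mum Dmu] Dt.
  rewrite -(subrK (D 1%N 0 t) (D 1%N 0 t0)) -addrA.
  rewrite (le_trans (ler_normD _ _))// (splitr e) lerD//.
  have -> : D 1%N 0 t - mu^-1 *: (z mu t - z 0 t) =
      - (mu^-1 *: (D 0%N (0 + mu) t - D 0%N 0 t - mu *: D 1%N 0 t)).
    by rewrite add0r !D0// [in RHS]scalerBr scalerA mulVf// scale1r opprB.
  rewrite normrN normrZ normfV mulrC ler_pdivrMr ?normr_gt0//.
split=> //.
near=> mu; split.
- by near: mu; exact: nbhs_dnbhs_neq.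
- by near: mu; exact: dnbhs0_lt.
- by near: mu; exact: cvg_within.
Unshelve. all: by end_near. Qed.

Lemma joint_cvg_at0 (R : realType) (V : normedModType R) (m : R)
    (z : R -> R -> V) (t0 : R) :
  0 < m -> smooth_in_BC m z -> z p.1 p.2 @[p --> joint R t0] --> z 0 t0.
Proof.
move=> m0 z_smooth; have [z1 /(_ t0) z1E] := first_variation m0 z_smooth.
have p10 := cvg_fst0 (t0 : R).
have p2t : z 0 p.2 @[p --> joint R t0] --> z 0 t0.
  apply: (cvg_comp snd (z 0)); first exact: cvg_snd.
  exact: smooth_in_BC_continuous0 m0 z_smooth t0.
have := cvgD (cvgZ p10 z1E) p2t; rewrite scale0r add0r => zl.
apply: cvg_trans (zl _ _); apply: near_eq_cvg.
near=> p; rewrite !fctE/= scalerA mulfV ?scale1r ?subrK//.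
by near: p; exact: near_fst_neq0.
Unshelve. all: by end_near. Qed.

(** * Consequences of the differential equations *)

Section variational_equations.
Context {R : realType} {n : nat}.
Implicit Types f g : 'rV[R]_n -> 'rV[R]_n.

Lemma Jac_continuous f : Ck 1 f -> continuous (Jac f).
Proof.
move=> C1f x; apply: (@cvg_trmx _ _ (nbhs x)); exact: jacobian_continuous.
Qed.

(** The velocity of [(u - y) / mu] is the sum of [v / mu], which tends to [v1],
    of [(f y - f u) / mu], which tends to [0] because [f] is locally Lipschitz,
    and of [g y - g u], which tends to [0] because [u] and [y] share the
    limit [p0]. *)
Lemma costate_variation_eq0 f g (y u v : R -> R -> 'rV[R]_n)
    (p0 v1 : 'rV[R]_n) t0 :
  Ck 1 f -> Ck 1 g ->
  (\forall mu \near (0 : R)^', solves_on setT (reversed f g mu) (y mu)) ->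
  (\forall mu \near (0 : R)^', forall t : R,
    is_derive t (1 : R) (u mu) (- f (u mu t) - mu *: g (u mu t) + v mu t)) ->
  y p.1 p.2 @[p --> joint R t0] --> p0 ->
  u p.1 p.2 @[p --> joint R t0] --> p0 ->
  (forall t, p.1^-1 *: (u p.1 p.2 - y p.1 p.2) @[p --> joint R t]
    --> (0 : 'rV[R]_n)) ->
  p.1^-1 *: v p.1 p.2 @[p --> joint R t0] --> v1 ->
  v1 = 0.
Proof.
move=> C1f C1g y_sol u_sol yp up uy0 vv1.
pose dx mu t := mu^-1 *: ((- f (u mu t) - mu *: g (u mu t) + v mu t)
                          - reversed f g mu (y mu t)).
apply: (@limit_derivative_eq0 _ _ _ _ (0 : R)^' _
  (fun mu t => mu^-1 *: (u mu t - y mu t)) dx t0) => [|t|].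
- apply: filterS2 y_sol u_sol => mu y_sol u_sol t.
  by apply: is_deriveZ; apply: is_deriveB => //; exact: y_sol.
- exact: (cvg_slice (x := fun mu t => mu^-1 *: (u mu t - y mu t)) (uy0 t)).
have cg : {for p0, continuous g} by exact/differentiable_continuous/C1g.1.
have FJ : Filter (joint R t0) by exact: filter_prod_filter.
have gup := continuous_cvg FJ cg up; have gyp := continuous_cvg FJ cg yp.
have fuy := cvg0_scaled_difference (FF := FJ) (c := fun p : R * R => p.1^-1)
  C1f up yp (uy0 t0).
have lim := cvgD (cvgB (cvgB gyp gup) fuy) vv1.
have -> : v1 = g p0 - g p0 - 0 + v1 by rewrite subrr subr0 add0r.
apply: cvg_trans (lim FJ FJ FJ); apply: near_eq_cvg.
near=> p.
rewrite /dx /reversed !fctE/=.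
have p10 : p.1 != 0 by near: p; exact: near_fst_neq0.
apply/matrixP => i j; rewrite !mxE; field.
exact: p10.
Unshelve. all: by end_near. Qed.

(** With [v = o(mu)], the only term in the velocity of [v / mu] that survives in
    the limit is the forcing [2 (g_u^* - g_u) (f + mu g)]. *)
Lemma skew_force_eq0 f g (u v : R -> R -> 'rV[R]_n) (p0 : 'rV[R]_n) t0 :
  Ck 1 f -> Ck 1 g ->
  (\forall mu \near (0 : R)^', forall t : R,
    is_derive t (1 : R) (v mu) (euler_lagrange f g mu (u mu t, v mu t)).2) ->
  u p.1 p.2 @[p --> joint R t0] --> p0 ->
  (forall t, p.1^-1 *: v p.1 p.2 @[p --> joint R t] --> (0 : 'rV[R]_n)) ->
  ((Jac g p0)^T - Jac g p0) *v f p0 = 0.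
Proof.
move=> C1f C1g v_sol up v0.
have FJ : Filter (joint R t0) by exact: filter_prod_filter.
have p10 := cvg_fst0 t0.
have vp : v p.1 p.2 @[p --> joint R t0] --> (0 : 'rV[R]_n).
  have := cvgZ (FF := FJ) p10 (v0 t0); rewrite scale0r.
  move=> lim; apply: cvg_trans lim; apply: near_eq_cvg; near=> p.
  by rewrite scalerA mulfV ?scale1r//; near: p; exact: near_fst_neq0.
have cJf := continuous_cvg FJ (Jac_continuous C1f (x := p0)) up.
have cJg := continuous_cvg FJ (Jac_continuous C1g (x := p0)) up.
have cf : {for p0, continuous f} by exact/differentiable_continuous/C1f.1.
have cg : {for p0, continuous g} by exact/differentiable_continuous/C1g.1.
have fup := continuous_cvg FJ cf up; have gup := continuous_cvg FJ cg up.
pose dx mu t := mu^-1 *: (euler_lagrange f g mu (u mu t, v mu t)).2.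
have twice0 : (2%:R *: ((Jac g p0)^T - Jac g p0)) *v f p0 = 0.
  apply: (@limit_derivative_eq0 _ _ _ _ (0 : R)^' _
    (fun mu t => mu^-1 *: v mu t) dx t0) => [|t|].
  - by apply: filterS v_sol => mu v_sol t; exact: is_deriveZ.
  - exact: (cvg_slice (x := fun mu t => mu^-1 *: v mu t) (v0 t)).
  have -> : (2%:R *: ((Jac g p0)^T - Jac g p0)) *v f p0 =
      (Jac f p0)^T *v 0 +
      ((2%:R *: ((Jac g p0)^T - Jac g p0)) *v (f p0 + 0 *: g p0) +
       (2%:R *: Jac g p0 - (Jac g p0)^T) *v 0).
    by rewrite /mulmxv !mul0mx scale0r !addr0 add0r.
  have two : (2%:R : R) @[p --> joint R t0] --> (2%:R : R) by exact: cvg_cst.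
  have cJgT := cvg_trmx (FF := FJ) cJg.
  have restoring := cvg_mulmxv (FF := FJ) (cvg_trmx (FF := FJ) cJf)
    (v0 t0).
  have forcing := cvg_mulmxv (FF := FJ)
    (cvgZ (FF := FJ) two (cvgB (FF := FJ) cJgT cJg))
    (cvgD (FF := FJ) fup (cvgZ (FF := FJ) p10 gup)).
  have coupling := cvg_mulmxv (FF := FJ)
    (cvgB (FF := FJ) (cvgZ (FF := FJ) two cJg) cJgT) vp.
  have := cvgD (FF := FJ) restoring (cvgD (FF := FJ) forcing coupling).
  move=> lim; apply: cvg_trans lim; apply: near_eq_cvg; near=> p.
  have pn0 : p.1 != 0 by near: p; exact: near_fst_neq0.
  rewrite /dx /euler_lagrange/= scalerDr scalerA mulVf// scale1r.
  by rewrite !fctE/= /mulmxv -scalemxAl.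
apply/eqP; move/eqP: twice0.
by rewrite /mulmxv linearZ/= -scalemxAr scaler_eq0 pnatr_eq0.
Unshelve. all: by end_near. Qed.

End variational_equations.

(** * A lower bound for the distance *)

Lemma bounded_fun_fst (R : realType) (V W : normedModType R) (T : Type)
    (z : T -> V * W) :
  bounded_fun z -> bounded_fun (fst \o z).
Proof.
move=> /ex_strict_bound_gt0[M _ zM]; exists M; split=> [|N MN t _].
  exact: num_real.
rewrite /= (le_trans _ (ltW (lt_trans (zM t I) MN)))//.
by rewrite prod_normE le_max lexx.
Qed.

(** The supremum of an unbounded set is a default value: only for a bounded
    range does a single time bound the supremum from below. *)
Lemma range_dist_ubound (R : realType) (V : normedModType R) (T : Type)
    (p q : T -> V) :
  bounded_fun p -> bounded_fun q ->
  has_ubound (range (fun t => `|p t - q t|)).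
Proof.
move=> /ex_strict_bound_gt0[M _ pM] /ex_strict_bound_gt0[N _ qN].
exists (M + N) => _ [t _ <-].
by rewrite (le_trans (ler_normB _ _))// lerD// ltW//; [exact: pM | exact: qN].
Qed.

Lemma dist_ge_of_variation (R : realType) (V : normedModType R)
    (x : R -> V) (w : V) :
  mu^-1 *: x mu @[mu --> (0 : R)^'] --> w -> w != 0 ->
  exists2 mu0, 0 < mu0 &
    forall mu, 0 < `|mu| < mu0 -> `|w| / 2 * `|mu| <= `|x mu|.
Proof.
move=> xw w0; have w20 : 0 < `|w| / 2 by rewrite divr_gt0// normr_gt0.
move/cvgrPdist_lt : xw => /(_ _ w20)/nbhs_ballP[e /= e0 xw].
exists e => // mu /andP[]; rewrite normr_gt0 => mu0 mue.
have close : `|w - mu^-1 *: x mu| < `|w| / 2.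
  by apply: xw => //; rewrite /ball/= sub0r normrN.
rewrite -ler_pdivlMr ?normr_gt0// [leRHS]mulrC -normfV -normrZ.
have := lerB_dist w (mu^-1 *: x mu); lra.
Qed.

Theorem theorem1 (R : realType) (n : nat) (f g : 'rV[R]_n -> 'rV[R]_n)
  (a b : 'rV[R]_n) (h : R -> 'rV[R]_n)
  (f_smooth : smooth f) (g_smooth : smooth g)
  (f_sym : forall x, Jac f x = (Jac f x)^T)
  (a_hyp : hyperbolic_equilibrium f a) (b_hyp : hyperbolic_equilibrium f b)
  (dim_a : manifold_dim (stable_manifold f a) (stable_tangent f a) n)
  (dim_b : manifold_dim (unstable_manifold f b) (unstable_tangent f b) 1)
  (h_sol : solves_on setT f h)
  (h0 : (unstable_manifold f b `&` stable_manifold f a) (h 0))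
  (h0_transverse :
     transverse (unstable_tangent f b (h 0)) (stable_tangent f a (h 0)))
  (m : R) (m_gt0 : 0 < m) (a_ b_ : R -> 'rV[R]_n)
  (a_eq : continues_equilibrium f g a m a_)
  (b_eq : continues_equilibrium f g b m b_)
  (y u v : R -> R -> 'rV[R]_n)
  (y_het : forall mu, `|mu| < m ->
     heteroclinic (reversed f g mu) (a_ mu) (b_ mu) (y mu))
  (uv_het : forall mu, `|mu| < m ->
     heteroclinic (euler_lagrange f g mu) (a_ mu, 0) (b_ mu, 0)
       (fun t => (u mu t, v mu t)))
  (y_smooth : smooth_in_BC m y)
  (uv_smooth : smooth_in_BC m (fun mu t => (u mu t, v mu t)))
  (y_0 : forall t, y 0 t = h (- t))
  (uv_0 : forall t, (u 0 t, v 0 t) = (h (- t), 0))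
  (skew : exists s : R,
     ((Jac g (h (- s)))^T - Jac g (h (- s))) *v f (h (- s)) <> 0) :
  exists delta mu0 : R, [/\ 0 < delta, 0 < mu0 &
    forall mu, 0 < `|mu| < mu0 ->
      delta * `|mu| <= sup (range (fun t : R => `|y mu t - u mu t|))].
Proof.
have C1f := f_smooth 1%N; have C1g := g_smooth 1%N.
have u0E t : u 0 t = h (- t) by case: (uv_0 t).
have v0E t : v 0 t = 0 by case: (uv_0 t).
have [y1 y1E] := first_variation m_gt0 y_smooth.
(* The components of [w1 t] are the variations of [u] and of [v] at time [t]. *)
have [w1 w1E] := first_variation m_gt0 uv_smooth.
have u1E t : p.1^-1 *: (u p.1 p.2 - u 0 p.2) @[p --> joint R t] --> (w1 t).1.
  by apply: (cvg_comp _ fst (w1E t)); exact: cvg_fst.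
have v1E t : p.1^-1 *: v p.1 p.2 @[p --> joint R t] --> (w1 t).2.
  have : p.1^-1 *: (v p.1 p.2 - v 0 p.2) @[p --> joint R t] --> (w1 t).2.
    by apply: (cvg_comp _ snd (w1E t)); exact: cvg_snd.
  by under eq_cvg do rewrite v0E subr0.
have uy1E t :
    p.1^-1 *: (u p.1 p.2 - y p.1 p.2) @[p --> joint R t] --> (w1 t).1 - y1 t.
  have FJ : Filter (joint R t) by exact: filter_prod_filter.
  have := cvgB (FF := FJ) (u1E t) (y1E t).
  move=> lim; apply: cvg_trans lim; apply: near_eq_cvg; near=> p.
  by rewrite !fctE/= u0E y_0 -scalerBr opprB addrA subrK.
have [t uy1] : exists t, (w1 t).1 - y1 t != 0.
  apply: contrapT => /forallNP uy1; have [s] := skew; apply.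
  have uy0 t : (w1 t).1 - y1 t = 0 by apply/eqP/negPn/negP/uy1.
  have near_m : \forall mu \near (0 : R)^', `|mu| < m by exact: dnbhs0_lt.
  have joint_u t : u p.1 p.2 @[p --> joint R t] --> h (- t).
    rewrite -u0E.
    apply: (cvg_comp _ fst (joint_cvg_at0 (t0 := t) m_gt0 uv_smooth)).
    exact: cvg_fst.
  have v10 t : (w1 t).2 = 0.
    apply: (costate_variation_eq0 (f := f) (g := g) (y := y) (u := u) (v := v)
      (p0 := h (- t)) (t0 := t)) => //.
    - by apply: filterS near_m => mu /y_het[].
    - apply: filterS near_m => mu /uv_het[uv_sol _ _] r.
      have fst_cont : continuous (@fst 'rV[R]_n 'rV[R]_n).
        by move=> ?; exact: cvg_fst.
      exact: (is_derive_linear (L := fst) fst_cont (uv_sol r I)).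
    - by rewrite -y_0; exact: joint_cvg_at0 m_gt0 y_smooth.
    - by move=> r; rewrite -(uy0 r).
  apply: (skew_force_eq0 (f := f) (g := g) (u := u) (v := v) (t0 := s)) => //.
  - apply: filterS near_m => mu /uv_het[uv_sol _ _] r.
    have snd_cont : continuous (@snd 'rV[R]_n 'rV[R]_n).
      by move=> ?; exact: cvg_snd.
    exact: (is_derive_linear (L := snd) snd_cont (uv_sol r I)).
  - by move=> r; rewrite -(v10 r).
have uy1_at_t :=
  cvg_slice (x := fun mu t => mu^-1 *: (u mu t - y mu t)) (uy1E t).
have [mu0 mu0_gt0 far] := dist_ge_of_variation (uy1_at_t _) uy1.
exists (`|(w1 t).1 - y1 t| / 2), (Num.min mu0 m); split.
- by rewrite divr_gt0// normr_gt0.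
- by rewrite lt_min mu0_gt0.
move=> mu /andP[mu_neq0]; rewrite lt_min => /andP[mu_mu0 mu_m].
have [Dy [Dy0 Dy_smooth]] := y_smooth.
have [Dw [Dw0 Dw_smooth]] := uv_smooth.
have y_bounded : bounded_fun (y mu).
  by rewrite -Dy0//; have [] := Dy_smooth 0%N mu mu_m.
have u_bounded : bounded_fun (u mu).
  apply: (@bounded_fun_fst _ _ _ _ (fun r => (u mu r, v mu r))).
  by rewrite -Dw0//; have [] := Dw_smooth 0%N mu mu_m.
apply: (@le_trans _ _ `|y mu t - u mu t|).
  by rewrite [leRHS]distrC far// mu_neq0.
apply: sup_ubound; first exact: range_dist_ubound.
by exists t.
Unshelve. all: by end_near. Qed.
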